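(* Let $m\ge 2$ be an integer. Every strongly connected digraph $D$ with $\delta^0(D)\ge\max\{2,m-1\}$ contains a dipath $P$ of order $m$ such that $D-A(P)$ is strongly connected.
   Context: All digraphs are finite (with nonempty vertex set), loopless, and have no parallel arcs; oppositely directed arcs $(u,v)$ and $(v,u)$ are allowed. For a vertex $v$ of a digraph $D$, $d_D^+(v)$ and $d_D^-(v)$ denote its outdegree and indegree. The minimum semidegree is $\delta^0(D)=\min\{\delta^+(D),\delta^-(D)\}$, where $\delta^+(D)=\min_{v\in V(D)} d_D^+(v)$ and $\delta^-(D)=\min_{v\in V(D)} d_D^-(v)$. A dipath is a directed path with pairwise distinct vertices; its order is its number of vertices. $A(P)$ denotes the set of arcs of $P$, and for a set $A$ of arcs of $D$, $D-A$ denotes the digraph obtained from $D$ by deleting all arcs in $A$ (keeping all vertices). *)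

(* Defs.v *)
From mathcomp Require Import all_boot.

Set Implicit Arguments.
Unset Strict Implicit.
Unset Printing Implicit Defensive.

(* A digraph on a finite vertex type V is given by its arc relation D : rel V
   (so there are no parallel arcs, and opposite arcs are allowed); loopless
   means irreflexive D. *)

Definition outdeg (V : finType) (D : rel V) (v : V) : nat := #|[set w | D v w]|.

Definition indeg (V : finType) (D : rel V) (v : V) : nat := #|[set w | D w v]|.

(* The default #|V| bounds every degree, so for nonempty V these are the
   genuine minima over the vertices. *)
Definition min_outdeg (V : finType) (D : rel V) : nat :=
  \big[minn/#|V|]_(v : V) outdeg D v.

Definition min_indeg (V : finType) (D : rel V) : nat :=
  \big[minn/#|V|]_(v : V) indeg D v.

Definition min_semideg (V : finType) (D : rel V) : nat :=
  minn (min_outdeg D) (min_indeg D).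

Definition strongly_connected (V : finType) (D : rel V) : Prop :=
  forall u v : V, connect D u v.

(* A dipath is given by its sequence of vertices; its order is size P. *)
Definition dipath (V : finType) (D : rel V) (P : seq V) : bool :=
  [&& P != [::], sorted D P & uniq P].

Definition path_arcs (V : finType) (P : seq V) : {set V * V} :=
  [set a in zip P (behead P)].

Definition del_arcs (V : finType) (D : rel V) (A : {set V * V}) : rel V :=
  [rel u v | D u v && ((u, v) \notin A)].

(* Main.v *)
(* With k = max(2, m - 1), the argument is by extremality: among the dipaths P
   with k arcs, take one for which the strong component X of a fixed vertex in
   D - A(P) is largest, and suppose X misses a vertex.  Let Q be a shortest
   X-ear of D (it leaves X, runs outside X and returns to X).  A dipath with k
   arcs that avoids A(Q) and all arcs inside X would leave X and Q strongly
   connected, contradicting the choice of P; so it suffices to find one.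
   - The vertices that do not reach X in D - A(P) (or dually those not reached
     from X) can only be left through arcs of P, so each of them keeps k - 2
     out-neighbours among them after the removal of A(Q): outside X and off
     A(Q) there is a dipath on k - 1 vertices.
   - Take such a dipath Z with as many vertices as possible.  All in-neighbours
     of its first vertex a, except at most one along Q, lie on Z or in X, and
     dually for its last vertex b.  If Z has k - 1 vertices, it can therefore
     be prolonged into X at both ends; the two new vertices can be made
     distinct, unless a and b are the first and last vertices of Q, and then
     exchanging the first arc of Q frees another arc into a.
   - If Z has k vertices and no rotation of Z can be prolonged into X, then Z
     spans a closed dipath whose vertices all lie on Q, and two of them are
     joined by arcs in both directions outside A(Q); one of these arcs is a
     shortcut of Q. *)

Require Import Defs.
From mathcomp Require Import all_boot.

Set Implicit Arguments.
Unset Strict Implicit.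
Unset Printing Implicit Defensive.

(** * Arcs of a vertex sequence *)

Lemma mem_arcsP (V : finType) (p : seq V) (u v : V) :
  reflect (exists p1 p2, p = p1 ++ u :: v :: p2) ((u, v) \in path_arcs p).
Proof.
rewrite inE; apply: (iffP idP) => [|[p1 [p2 ->]]]; last first.
  elim: p1 => [|a p1 IH] /=; first by rewrite inE eqxx.
  by case: p1 IH => [|b p1] /= IH; rewrite inE IH orbT.
elim: p => [//|a p IH]; case: p IH => [//|b p] IH /=.
rewrite inE => /orP[/eqP[-> ->]|/IH[p1 [p2 ->]]]; first by exists [::], p.
by exists (a :: p1), p2.
Qed.

Lemma sorted_arcs (V : finType) (e : rel V) (p : seq V) :
  sorted e p <-> forall u v, (u, v) \in path_arcs p -> e u v.
Proof.
split=> [sp u v /mem_arcsP[p1 [p2 Dp]]|H].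
  by move: sp; rewrite Dp => /cat_sorted2[_] /andP[].
elim: p H => [//|a p IH]; case: p IH => [//|b p] IH H /=.
rewrite H ?inE ?eqxx //=; apply: IH => u v uv; apply: H.
by move: uv; rewrite !inE /= => ->; rewrite orbT.
Qed.

Lemma arcs_cons (V : finType) (x : V) (q : seq V) (u v : V) :
  u != x -> (u, v) \in path_arcs (x :: q) -> (u, v) \in path_arcs q.
Proof.
case: q => [|a q] ux; rewrite !inE //=.
by rewrite xpair_eqE (negPf ux).
Qed.

Lemma arcs_consr (V : finType) (x : V) (q : seq V) (u v : V) :
  (u, v) \in path_arcs q -> (u, v) \in path_arcs (x :: q).
Proof. by case/mem_arcsP=> p1 [p2 ->]; apply/mem_arcsP; exists (x :: p1), p2. Qed.

Lemma arcs_rcons (V : finType) (y : V) (q : seq V) (u v : V) :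
  v != y -> (u, v) \in path_arcs (rcons q y) -> (u, v) \in path_arcs q.
Proof.
move=> vy /mem_arcsP[p1 [p2]]; case/lastP: p2 => [|p2 z].
  rewrite -[[:: u; v]]/(rcons [:: u] v) -rcons_cat => /rcons_inj[_ yv].
  by rewrite yv eqxx in vy.
rewrite -!rcons_cons -rcons_cat => /rcons_inj[-> _].
by apply/mem_arcsP; exists p1, p2.
Qed.

Lemma arcs_mem (V : finType) (q : seq V) (u v : V) :
  (u, v) \in path_arcs q -> (u \in q) && (v \in q).
Proof. by case/mem_arcsP=> p1 [p2 ->]; rewrite !mem_cat !inE !eqxx !orbT. Qed.

Lemma uniq_succ (V : finType) (p : seq V) (u v v' : V) : uniq p ->
  (u, v) \in path_arcs p -> (u, v') \in path_arcs p -> v = v'.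
Proof.
move=> Up /mem_arcsP[p1 [p2 Dp]] /mem_arcsP[p3 [p4 Dp']].
have i1 : index u p = size p1.
  rewrite Dp index_cat /= eqxx addn0; case: ifP => // up.
  by move: Up; rewrite Dp cat_uniq /= up /= andbF.
have i3 : index u p = size p3.
  rewrite Dp' index_cat /= eqxx addn0; case: ifP => // up.
  by move: Up; rewrite Dp' cat_uniq /= up /= andbF.
have : nth u p (index u p).+1 = v.
  by rewrite i1 Dp nth_cat ltnNge leqnSn /= subSn // subnn.
by rewrite i3 Dp' nth_cat ltnNge leqnSn /= subSn // subnn /= => ->.
Qed.

Lemma uniq_pred (V : finType) (p : seq V) (u u' v : V) : uniq p ->
  (u, v) \in path_arcs p -> (u', v) \in path_arcs p -> u = u'.
Proof.
have arcs_rev w : (w, v) \in path_arcs p -> (v, w) \in path_arcs (rev p).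
  case/mem_arcsP=> p1 [p2 ->]; apply/mem_arcsP; exists (rev p2), (rev p1).
  by rewrite rev_cat !rev_cons -!cats1 -!catA.
by rewrite -rev_uniq => Up /arcs_rev + /arcs_rev; apply: uniq_succ.
Qed.

Lemma card_le1 (V : finType) (A : {set V}) :
  (forall a b, a \in A -> b \in A -> a = b) -> #|A| <= 1.
Proof. by move=> H; apply/card_le1_eqP => a b aA bA; apply: H. Qed.

(** * Greedy dipaths inside a vertex set *)

(** While the path has at most [n] vertices, its first vertex has more in-neighbours in [B] than the
    path has further vertices; one of them is off the path and is prepended. *)
Lemma long_path_in (V : finType) (e : rel V) (B : {set V}) (n : nat) :
  irreflexive e -> B != set0 ->
  (forall v, v \in B -> n <= #|[set w in B | e w v]|) ->
  exists p, [/\ uniq p, sorted e p, {subset p <= B} & size p = n.+1].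
Proof.
move=> e_irr /set0Pn[b bB] deg.
suff: forall j, j <= n ->
    exists p, [/\ uniq p, sorted e p, {subset p <= B} & size p = j.+1].
  by apply.
elim=> [_|j IH jn].
  by exists [:: b]; split=> // v; rewrite inE => /eqP->.
have [[|a p] [Up sp pB] //= [szp]] := IH (ltnW jn).
have [w] : exists w, w \in [set w in B | e w a] :\: [set w in p].
  apply/set0Pn; rewrite -card_gt0 cardsD subn_gt0.
  apply: leq_trans (deg a (pB a (mem_head _ _))).
  apply: leq_ltn_trans (subset_leq_card (subsetIr _ _)) _.
  by rewrite cardsE (card_uniqP _) ?szp //; case/andP: Up.
rewrite !inE => /andP[wp /andP[wB ewa]].
exists (w :: a :: p); split; last by rewrite /= szp.
- by rewrite cons_uniq Up andbT inE negb_or wp andbT;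
    apply: contraTneq ewa => ->; rewrite e_irr.
- by rewrite /= ewa.
- by move=> v; rewrite inE => /orP[/eqP->//|/pB].
Qed.

Lemma long_path_out (V : finType) (e : rel V) (B : {set V}) (n : nat) :
  irreflexive e -> B != set0 ->
  (forall v, v \in B -> n <= #|[set w in B | e v w]|) ->
  exists p, [/\ uniq p, sorted e p, {subset p <= B} & size p = n.+1].
Proof.
move=> e_irr B0 deg.
have [p [Up sp pB szp]] := @long_path_in V (fun x y => e y x) B n e_irr B0 deg.
exists (rev p); split; rewrite ?rev_uniq ?size_rev ?rev_sorted //.
by move=> v; rewrite mem_rev => /pB.
Qed.

(** * Shortest ears *)

(** Tuples of a fixed length form a finite type, so having a witness of length [n] becomes boolean
    and a least [n] can be taken. *)
Lemma exists_min_size (V : finType) (P : pred (seq V)) :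
  (exists q, P q) -> exists2 q, P q & forall q', P q' -> size q <= size q'.
Proof.
case=> q0 Pq0.
have ex : exists n, [exists t : n.-tuple V, P t].
  by exists (size q0); apply/existsP; exists (in_tuple q0).
case: (ex_minnP ex) => n /existsP[t Pt] minn.
exists t => // q' Pq'; rewrite size_tuple; apply: minn.
by apply/existsP; exists (in_tuple q').
Qed.

(* The interior vertices are listed in q; the ends x and y may coincide. *)
Definition ear (V : finType) (D : rel V) (X : {set V}) (x : V) (q : seq V)
    (y : V) : bool :=
  [&& uniq q, q != [::], all (fun w => w \notin X) q, x \in X, y \in X
    & path D x (rcons q y)].

Lemma exit_path (V : finType) (D : rel V) (X : {set V}) (w : V) (p : seq V) :
  path D w p -> w \notin X -> last w p \in X ->
  exists q y, [/\ path D w (rcons q y), all (fun w => w \notin X) (w :: q) & y \in X].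
Proof.
elim: p w => [|a p IH] w /=; first by move=> _ /negPf->.
case/andP=> Dwa pa wX lX; have [aX|aX] := boolP (a \in X).
  by exists [::], a; rewrite /= Dwa wX.
have [q [y [pq /= qX yX]]] := IH a pa aX lX.
by exists (a :: q), y; rewrite /= Dwa wX.
Qed.

Lemma enter_arc (V : finType) (D : rel V) (X : {set V}) (x : V) (p : seq V) :
  path D x p -> x \in X -> last x p \notin X ->
  exists u v, [/\ u \in X, v \notin X & D u v].
Proof.
elim: p x => [|a p IH] x /=; first by move=> _ ->.
case/andP=> Dxa pa xX lX; have [aX|aX] := boolP (a \in X); first exact: IH pa aX lX.
by exists x, a.
Qed.

(** Follow a dipath from [x] to [w] up to its first exit from [X], then a dipath back to [x] up to
    its first re-entry. Only the part outside [X] is made repetition-free. *)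
Lemma ear_exists (V : finType) (D : rel V) (X : {set V}) (x w : V) :
  strongly_connected D -> x \in X -> w \notin X ->
  exists u q y, ear D X u q y.
Proof.
move=> Dst xX wX.
have /connectP[p pp lp] := Dst x w.
have [|u [v [uX vX Duv]]] := enter_arc pp xX; first by rewrite -lp.
have /connectP[p' pp' lp'] := Dst v x.
have [|q [y [pq qX yX]]] := exit_path pp' vX; first by rewrite -lp'.
move: pq; rewrite rcons_path => /andP[pq Dly].
case/shortenP: pq Dly => q' pq' Uq' sq' Dly.
exists u, (v :: q'), y; rewrite /ear Uq' uX yX /= Duv rcons_path pq' vX Dly !andbT.
by apply/allP=> z /sq' zq; move/allP: qX => /(_ z); rewrite inE zq orbT; apply.
Qed.

Lemma min_ear_exists (V : finType) (D : rel V) (X : {set V}) (x w : V) :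
  strongly_connected D -> x \in X -> w \notin X ->
  exists u q y, ear D X u q y /\
    forall u' q' y', ear D X u' q' y' -> size q <= size q'.
Proof.
move=> Dst xX wX; have [u0 [q0 [y0 e0]]] := ear_exists Dst xX wX.
pose P q := [exists u, exists y, ear D X u q y].
have [|q /existsP[u /existsP[y e]] qmin] := @exists_min_size V P.
  by exists q0; apply/existsP; exists u0; apply/existsP; exists y0.
exists u, q, y; split=> // u' q' y' e'; apply: qmin.
by apply/existsP; exists u'; apply/existsP; exists y'.
Qed.

Lemma ear_suffix (V : finType) (D : rel V) (X : {set V}) (x x' y v : V) q1 q2 :
  ear D X x (q1 ++ v :: q2) y -> x' \in X -> D x' v -> ear D X x' (v :: q2) y.
Proof.
case/and5P; rewrite cat_uniq all_cat rcons_cat cat_path.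
case/and3P=> _ _ Uq _ /andP[_ aq] xX /andP[yX /andP[_ /= /andP[_ pq]]] x'X Dx'v.
by rewrite /ear x'X yX aq Uq /= Dx'v pq.
Qed.

Lemma ear_prefix (V : finType) (D : rel V) (X : {set V}) (x y y' v : V) q1 q2 :
  ear D X x (q1 ++ v :: q2) y -> y' \in X -> D v y' -> ear D X x (rcons q1 v) y'.
Proof.
rewrite -cat_rcons.
case/and5P; rewrite cat_uniq all_cat rcons_cat cat_path.
case/andP=> Uq _ _ /andP[aq _] xX /andP[yX /andP[pq _]] y'X Dvy'.
rewrite /ear xX y'X aq Uq rcons_path pq last_rcons Dvy' /=.
by case: (q1).
Qed.

Lemma ear_cut (V : finType) (D : rel V) (X : {set V}) (x y u v : V) q1 q2 q3 :
  ear D X x (q1 ++ u :: q2 ++ v :: q3) y -> D u v ->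
  ear D X x (q1 ++ u :: v :: q3) y.
Proof.
move=> + Duv; case/and5P=> Uq _ aq xX /andP[yX pq].
have sub : subseq (q1 ++ u :: v :: q3) (q1 ++ u :: q2 ++ v :: q3).
  by rewrite cat_subseq //= eqxx suffix_subseq.
rewrite /ear xX yX (subseq_uniq sub Uq) /=; apply/and3P; split.
- by case: (q1).
- by apply/allP=> z /(mem_subseq sub) zq; move/allP: aq; apply.
move: pq; rewrite !rcons_cat !cat_path /= rcons_cat cat_path /=.
by case/and5P=> -> -> _ _ ->; rewrite Duv.
Qed.

Lemma min_ear_head (V : finType) (D : rel V) (X : {set V}) (x y x' v : V) q :
  ear D X x q y -> (forall u' q' y', ear D X u' q' y' -> size q <= size q') ->
  v \in q -> x' \in X -> D x' v -> v = head x q.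
Proof.
move=> eq + vq; case/splitPr: vq eq => q1 q2 eq qmin x'X Dx'v.
have := qmin _ _ _ (ear_suffix eq x'X Dx'v).
by case: q1 {eq qmin} => //= a q1; rewrite size_cat /= ltnNge leq_addl.
Qed.

Lemma min_ear_last (V : finType) (D : rel V) (X : {set V}) (x y y' v : V) q :
  ear D X x q y -> (forall u' q' y', ear D X u' q' y' -> size q <= size q') ->
  v \in q -> y' \in X -> D v y' -> v = last x q.
Proof.
move=> eq + vq; case/splitPr: vq eq => q1 q2 eq qmin y'X Dvy'.
have := qmin _ _ _ (ear_prefix eq y'X Dvy').
rewrite last_cat size_cat size_rcons /=.
by case: q2 {eq qmin} => //= a q2; rewrite !addnS ltnNge leq_addr.
Qed.

(** One of the two arcs points forward along [q]. It bypasses a section of the ear, empty by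
    minimality, so it would be an arc of the ear. *)
Lemma min_ear_chord (V : finType) (D : rel V) (X : {set V}) (x y u v : V) q :
  ear D X x q y -> (forall u' q' y', ear D X u' q' y' -> size q <= size q') ->
  u \in q -> v \in q -> u != v -> D u v -> D v u ->
  (u, v) \notin path_arcs (x :: rcons q y) ->
  (v, u) \notin path_arcs (x :: rcons q y) -> False.
Proof.
move=> eq qmin.
have jump a b q1 q2 q3 : q = q1 ++ a :: q2 ++ b :: q3 -> D a b ->
    (a, b) \notin path_arcs (x :: rcons q y) -> False.
  move=> Dq Dab /mem_arcsP[].
  have e' := eq; rewrite Dq in e'.
  have := qmin _ _ _ (ear_cut e' Dab).
  rewrite Dq !size_cat /= size_cat /= leq_add2l !ltnS -{2}[(size q3).+1]add0n.
  rewrite leq_add2r leqn0 size_eq0 => /eqP->.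
  by exists (x :: q1), (rcons q3 y); rewrite rcons_cat.
move=> uq; have [q1 [q2 Dq]] : exists q1 q2, q = q1 ++ u :: q2.
  by case/splitPr: uq => q1 q2; exists q1, q2.
rewrite {1}Dq mem_cat inE => /or3P[vq|/eqP->|vq]; rewrite ?eqxx // => _ Duv Dvu nuv nvu.
  case/splitPr: vq Dq => q3 q4; rewrite -catA => Dq.
  exact: jump Dq Dvu nvu.
case/splitPr: vq Dq => q3 q4 Dq.
exact: jump Dq Duv nuv.
Qed.

(** * Strong components and how they grow *)

Definition scc (V : finType) (e : rel V) (x : V) : {set V} :=
  [set v | connect e x v && connect e v x].

(** A dipath between two vertices of a strong component stays in it. Hence deleting arcs not inside
    the component leaves it strongly connected. *)
Lemma scc_connect (V : finType) (e : rel V) (x u v : V) :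
  u \in scc e x -> v \in scc e x ->
  connect [rel a b | [&& e a b, a \in scc e x & b \in scc e x]] u v.
Proof.
move=> uX vX; have /connectP[p pp lp] : connect e u v.
  move: uX vX; rewrite !inE => /andP[_ ux] /andP[xv _].
  exact: connect_trans ux xv.
elim: p u uX pp lp => [|a p IH] u uX /=; first by move=> _ ->; apply: connect0.
case/andP=> ua pa lp; have aX : a \in scc e x.
  move: uX vX; rewrite !inE => /andP[xu _] /andP[_ vx].
  rewrite (connect_trans xu (connect1 ua)) /=; apply: connect_trans vx.
  by apply/connectP; exists p.
apply: connect_trans (IH a aX pa lp); apply: connect1.
by rewrite /= ua uX aX.
Qed.

(** The arcs that can be deleted without harming the component [X] or the ear with arc set [A]. *)
Definition fresh (V : finType) (D : rel V) (X : {set V}) (A : {set V * V}) :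
    rel V :=
  [rel u v | [&& D u v, (u, v) \notin A & ~~ ((u \in X) && (v \in X))]].

Lemma fresh_path_grows (V : finType) (D : rel V) (P P' : seq V) (x0 x y : V) q :
  let X := scc (del_arcs D (path_arcs P)) x0 in
  ear D X x q y -> sorted (fresh D X (path_arcs (x :: rcons q y))) P' ->
  #|X| < #|scc (del_arcs D (path_arcs P')) x0|.
Proof.
move=> X eq /sorted_arcs fP'; set e := del_arcs D (path_arcs P').
have x0X : x0 \in X by rewrite inE connect0.
have Xconn u v : u \in X -> v \in X -> connect e u v.
  move=> uX vX; have := scc_connect uX vX; apply: connect_sub => a b /=.
  case/and3P=> /andP[Dab _] aX bX; apply: connect1; rewrite /e /del_arcs /= Dab /=.
  by apply/negP => /fP' /and3P[_ _]; rewrite -/X aX bX.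
case/and5P: eq fP' => _ q0 aq xX /andP[yX pq] fP'.
have : path e x (rcons q y).
  rewrite -[path _ _ _]/(sorted e (x :: rcons q y)); apply/sorted_arcs => u v uv.
  rewrite /e /del_arcs /= (proj1 (sorted_arcs D (x :: rcons q y)) pq u v uv) /=.
  by apply/negP => /fP' /and3P[_]; rewrite uv.
case: q q0 aq {pq fP'} => [//|a q] _ /andP[aX _] /= /andP[xa pa].
apply: proper_card; apply/properP; split.
  by apply/subsetP => v vX; rewrite inE !Xconn.
exists a => //; rewrite inE (connect_trans (Xconn _ _ x0X xX) (connect1 xa)) /=.
apply: connect_trans (Xconn _ _ yX x0X).
by apply/connectP; exists (rcons q y); rewrite ?last_rcons.
Qed.

(** * Degree counts relative to an ear *)

(** A vertex outside [X] differs from both ends, so it occurs at most once on the ear, even when the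
    ends coincide. *)
Lemma ear_succ_card (V : finType) (D : rel V) (X : {set V}) (x y w : V) q :
  ear D X x q y -> w \notin X ->
  #|[set v | (w, v) \in path_arcs (x :: rcons q y)]| <= (w \in q).
Proof.
case/and5P=> Uq _ aq xX /andP[yX _] wX.
have wx : w != x by apply: contraNneq wX => ->.
have wy : w != y by apply: contraNneq wX => ->.
have Uqy : uniq (rcons q y).
  by rewrite rcons_uniq Uq andbT; apply/negP => /(allP aq); rewrite yX.
case: (boolP (w \in q)) => wq; last first.
  rewrite leqn0 cards_eq0; apply/eqP/setP => v; rewrite in_set in_set0.
  apply/negP => /arcs_mem /andP[]; rewrite inE mem_rcons inE.
  by rewrite (negPf wx) (negPf wy) (negPf wq).
apply: card_le1 => a b; rewrite in_set => wa; rewrite in_set => wb.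
exact: uniq_succ Uqy (arcs_cons wx wa) (arcs_cons wx wb).
Qed.

Lemma ear_pred_card (V : finType) (D : rel V) (X : {set V}) (x y w : V) q :
  ear D X x q y -> w \notin X ->
  #|[set v | (v, w) \in path_arcs (x :: rcons q y)]| <= (w \in q).
Proof.
case/and5P=> Uq _ aq xX /andP[yX _] wX.
have wx : w != x by apply: contraNneq wX => ->.
have wy : w != y by apply: contraNneq wX => ->.
have Uxq : uniq (x :: q).
  by rewrite /= Uq andbT; apply/negP => /(allP aq); rewrite xX.
case: (boolP (w \in q)) => wq; last first.
  rewrite leqn0 cards_eq0; apply/eqP/setP => v; rewrite in_set in_set0.
  apply/negP => /arcs_mem /andP[_]; rewrite inE mem_rcons inE.
  by rewrite (negPf wx) (negPf wy) (negPf wq).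
rewrite -rcons_cons; apply: card_le1 => a b; rewrite in_set => wa; rewrite in_set => wb.
exact: uniq_pred Uxq (arcs_rcons wy wa) (arcs_rcons wy wb).
Qed.

Lemma card_cover3 (V : finType) (N A B C : {set V}) (k b : nat) :
  k <= #|N| -> N \subset A :|: (B :|: C) -> #|B| <= b -> k <= #|A| + b + #|C|.
Proof.
move=> kN sN Bb; apply: leq_trans kN (leq_trans (subset_leq_card sN) _).
apply: leq_trans (leq_card_setU _ _) _; rewrite -addnA leq_add2l.
by apply: leq_trans (leq_card_setU _ _) _; rewrite leq_add2r.
Qed.

(** An arc into [a] either is the only possible ear arc into [a] or is fresh, since [a] is outside
    [X]; a fresh one starts in [X] or on [Z], as [a :: Z] cannot be prolonged outside [X]. *)
Lemma in_count (V : finType) (D : rel V) (X : {set V}) (x y a : V) q Z k :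
  irreflexive D -> ear D X x q y -> a \notin X -> k <= indeg D a ->
  (forall w, w \notin X -> w \notin a :: Z ->
    ~~ fresh D X (path_arcs (x :: rcons q y)) w a) ->
  k <= #|[set w in X | fresh D X (path_arcs (x :: rcons q y)) w a]| + (a \in q)
       + #|[set w in Z | fresh D X (path_arcs (x :: rcons q y)) w a]|.
Proof.
set A := path_arcs _ => irr eq aX degk maxZ.
apply: (@card_cover3 _ [set w | D w a] _ _ _ _ _ degk _ (ear_pred_card eq aX)).
apply/subsetP => w.
rewrite in_set => Dwa; rewrite !in_setU !(in_set _ w).
rewrite -/A; case: (boolP ((w, a) \in A)) => [_|wA]; rewrite ?orTb ?orbT //.
have Fwa : fresh D X A w a by rewrite /fresh /= Dwa wA (negPf aX) andbF.
rewrite Fwa !andbT /=; apply/negPn/negP; rewrite negb_or => /andP[wX wZ].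
have := maxZ w wX; rewrite Fwa inE (negPf wZ) orbF.
by case: eqP => [wa|_ /(_ isT)//]; move: Dwa; rewrite wa irr.
Qed.

Lemma out_count (V : finType) (D : rel V) (X : {set V}) (x y a : V) q Z k :
  irreflexive D -> ear D X x q y -> a \notin X -> k <= outdeg D a ->
  (forall w, w \notin X -> w \notin a :: Z ->
    ~~ fresh D X (path_arcs (x :: rcons q y)) a w) ->
  k <= #|[set w in X | fresh D X (path_arcs (x :: rcons q y)) a w]| + (a \in q)
       + #|[set w in Z | fresh D X (path_arcs (x :: rcons q y)) a w]|.
Proof.
set A := path_arcs _ => irr eq aX degk maxZ.
apply: (@card_cover3 _ [set w | D a w] _ _ _ _ _ degk _ (ear_succ_card eq aX)).
apply/subsetP => w.
rewrite in_set => Dwa; rewrite !in_setU !(in_set _ w).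
rewrite -/A; case: (boolP ((a, w) \in A)) => [_|wA]; rewrite ?orTb ?orbT //.
have Fwa : fresh D X A a w by rewrite /fresh /= Dwa wA (negPf aX).
rewrite Fwa !andbT /=; apply/negPn/negP; rewrite negb_or => /andP[wX wZ].
have := maxZ w wX; rewrite Fwa inE (negPf wZ) orbF.
by case: eqP => [wa|_ /(_ isT)//]; move: Dwa; rewrite wa irr.
Qed.

Lemma card_seq_filter (V : finType) (Z : seq V) (P : pred V) :
  #|[set w in Z | P w]| <= size Z.
Proof.
apply: leq_trans (subset_leq_card _) (card_size Z).
by apply/subsetP => w; rewrite in_set => /andP[].
Qed.

(** Here [k.+2] is the degree bound, the number called k in the overview. An arc leaving [B] (or
    dually entering it) must lie on [P], so each vertex of [B] loses at most one neighbour to [P]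
    and one to the ear, and keeps [k] in [B]. *)
Lemma inner_path (V : finType) (D : rel V) (P : seq V) (x0 x y w : V) q k :
  let X := scc (del_arcs D (path_arcs P)) x0 in
  irreflexive D -> (forall v, k.+2 <= outdeg D v) -> (forall v, k.+2 <= indeg D v) ->
  uniq P -> ear D X x q y -> w \notin X ->
  exists Z, [/\ uniq Z, sorted (fresh D X (path_arcs (x :: rcons q y))) Z,
    all (fun w => w \notin X) Z & size Z = k.+1].
Proof.
move=> X irr dout din UP eq wX; set F := fresh _ _ _.
set D' := del_arcs D (path_arcs P).
have Firr : irreflexive F by move=> v; rewrite /F /fresh /= irr.
have : (~~ connect D' w x0) || (~~ connect D' x0 w).
  by move: wX; rewrite inE negb_and orbC.
case/orP=> wB.
- pose B := [set v | ~~ connect D' v x0].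
  have BX v : v \in B -> v \notin X by rewrite !inE negb_and => ->; rewrite orbT.
  have [||Z [UZ sZ ZB szZ]] := @long_path_out V F B k Firr; last first.
  + by exists Z; split=> //; apply/allP => v /ZB /BX.
  + move=> v vB; have vX := BX v vB.
    suff : k.+2 <= #|[set w in B | F v w]| + (v \in q)
                   + #|[set w | (v, w) \in path_arcs P]|.
      have P1 : #|[set w | (v, w) \in path_arcs P]| <= 1.
        by apply: card_le1 => a b; rewrite (in_set _ a) (in_set _ b); apply: uniq_succ.
      move=> H; have := leq_trans H (leq_add (leq_add (leqnn _) (leq_b1 _)) P1).
      by rewrite !addn1 !ltnS.
    apply: (@card_cover3 _ [set w | D v w] _ _ _ _ _ (dout v) _
      (ear_succ_card eq vX)); apply/subsetP => u.
    rewrite in_set => Dvu; rewrite !in_setU !(in_set _ u).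
    case: (boolP ((v, u) \in path_arcs P)) => [_|vuP]; rewrite ?orbT // orbF.
    case: (boolP ((v, u) \in path_arcs (x :: rcons q y))) => [_|vuQ]; rewrite ?orbT // orbF.
    rewrite /F /fresh /= Dvu vuQ (negPf vX) /= andbT.
    move: vB; rewrite in_set; apply: contra => cu.
    by apply: connect_trans cu; apply: connect1; rewrite /D' /del_arcs /= Dvu vuP.
  + by apply/set0Pn; exists w; rewrite in_set.
- pose B := [set v | ~~ connect D' x0 v].
  have BX v : v \in B -> v \notin X by rewrite !inE negb_and => ->.
  have [||Z [UZ sZ ZB szZ]] := @long_path_in V F B k Firr; last first.
  + by exists Z; split=> //; apply/allP => v /ZB /BX.
  + move=> v vB; have vX := BX v vB.
    suff : k.+2 <= #|[set w in B | F w v]| + (v \in q)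
                   + #|[set w | (w, v) \in path_arcs P]|.
      have P1 : #|[set w | (w, v) \in path_arcs P]| <= 1.
        by apply: card_le1 => a b; rewrite (in_set _ a) (in_set _ b); apply: uniq_pred.
      move=> H; have := leq_trans H (leq_add (leq_add (leqnn _) (leq_b1 _)) P1).
      by rewrite !addn1 !ltnS.
    apply: (@card_cover3 _ [set w | D w v] _ _ _ _ _ (din v) _
      (ear_pred_card eq vX)); apply/subsetP => u.
    rewrite in_set => Dvu; rewrite !in_setU !(in_set _ u).
    case: (boolP ((u, v) \in path_arcs P)) => [_|vuP]; rewrite ?orbT // orbF.
    case: (boolP ((u, v) \in path_arcs (x :: rcons q y))) => [_|vuQ]; rewrite ?orbT // orbF.
    rewrite /F /fresh /= Dvu vuQ (negPf vX) /= andbF andbT.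
    move: vB; rewrite in_set; apply: contra => cu.
    by apply: connect_trans cu _; apply: connect1; rewrite /D' /del_arcs /= Dvu vuP.
  + by apply/set0Pn; exists w; rewrite in_set.
Qed.

(** * Replacing a dipath by one that leaves a larger component *)

(** Cases on whether fresh dipaths of order [k.+3] or [k.+2] exist outside [X]; order [k.+1] is
    always available from [inner_path]. The missing vertices are taken from [X]. *)
Lemma grow_scc (V : finType) (D : rel V) (P : seq V) (x0 w : V) k :
  let X := scc (del_arcs D (path_arcs P)) x0 in
  irreflexive D -> strongly_connected D ->
  (forall v, k.+2 <= outdeg D v) -> (forall v, k.+2 <= indeg D v) ->
  uniq P -> w \notin X ->
  exists P', [/\ uniq P', sorted D P', size P' = k.+3
    & #|X| < #|scc (del_arcs D (path_arcs P')) x0|].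
Proof.
move=> X irr Dst dout din UP wX.
have x0X : x0 \in X by rewrite inE connect0.
have [x [q [y [eq qmin]]]] := min_ear_exists Dst x0X wX.
(* The ends of the ear are left free because the last case changes its starting vertex. *)
have win x' y' P' : ear D X x' q y' -> uniq P' -> size P' = k.+3 ->
    sorted (fresh D X (path_arcs (x' :: rcons q y'))) P' ->
    exists P', [/\ uniq P', sorted D P', size P' = k.+3
      & #|X| < #|scc (del_arcs D (path_arcs P')) x0|].
  move=> eq' UP' szP' sP'; exists P'; split=> //; last exact: fresh_path_grows eq' sP'.
  by apply: sub_sorted sP' => u v /and3P[].
set A := path_arcs (x :: rcons q y); pose F := fresh D X A.
pose inner n := [exists t : n.-tuple V,
  [&& uniq t, sorted F t & all (fun w => w \notin X) t]].
have innerT Z n : uniq Z -> sorted F Z -> all (fun w => w \notin X) Z ->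
    size Z = n -> inner n.
  move=> UZ sZ aZ <-; apply/existsP; exists (in_tuple Z).
  by rewrite UZ sZ aZ.
have FD u v : F u v -> D u v by case/and3P.
have FA u v : F u v -> (u, v) \notin A by case/and3P.
case: (boolP (inner k.+3)) => [/existsP[t /and3P[Ut st _]]|no3].
  by apply: win eq Ut _ st; rewrite size_tuple.
case: (boolP (inner k.+2)) => [/existsP[t /and3P[Ut st at_]]|no2].
  (* With no fresh arc from [X] into [a], the [k.+2] in-neighbours are at most one along the ear and
     [k.+1] on [Z]; the count is tight, so both bounds are attained. *)
  have head_full a Z : uniq (a :: Z) -> sorted F (a :: Z) ->
      all (fun w => w \notin X) (a :: Z) -> size Z = k.+1 ->
      [set w in X | F w a] = set0 -> (a \in q) && all (F^~ a) Z.
    move=> UZ sZ aZ szZ S0; have /andP[aX _] := aZ.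
    have := @in_count _ D X x y a q Z k.+2 irr eq aX (din a).
    rewrite -/A -/F S0 cards0 add0n => H.
    have {}H : k.+2 <= (a \in q) + #|[set w in Z | F w a]|.
      apply: H => u uX uZ; apply: contra no3 => Fua.
      apply: (innerT (u :: a :: Z)); rewrite /= ?szZ //.
      - by move: UZ; rewrite /= uZ.
      - by rewrite Fua.
      - by rewrite uX.
    have aq : a \in q.
      apply: contraLR H => /negPf->; rewrite add0n -ltnNge ltnS -szZ.
      exact: card_seq_filter.
    rewrite aq /=; move: H; rewrite aq add1n ltnS => H.
    have : [set w in Z | F w a] == [set w in Z].
      rewrite eqEcard; apply/andP; split.
        by apply/subsetP => u; rewrite !(in_set _ u) => /andP[].
      by rewrite cardsE (card_uniqP _) ?szZ //; case/andP: UZ.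
    move/eqP/setP => ZE; apply/allP => u uZ.
    by have := ZE u; rewrite !(in_set _ u) uZ.
  (* The first alternative speaks of all such dipaths, so that it also applies to a rotation of the
     given one. *)
  have [S0|[a [Z [u [Dt uX Fua]]]]] :
      (forall a Z, uniq (a :: Z) -> sorted F (a :: Z) ->
        all (fun w => w \notin X) (a :: Z) -> size Z = k.+1 ->
        [set w in X | F w a] = set0) \/
      exists a Z u, [/\ [&& uniq (a :: Z), sorted F (a :: Z),
        all (fun w => w \notin X) (a :: Z) & size Z == k.+1], u \in X & F u a].
    case: (boolP [exists t : k.+2.-tuple V, [exists u, [&& uniq t, sorted F t,
        all (fun w => w \notin X) t, u \in X & F u (head u t)]]]).
      case/existsP=> [[[|a Z] //= szt]] /existsP[u /and5P[UZ sZ aZ uX Fua]].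
      by right; exists a, Z, u; split=> //; rewrite UZ sZ aZ.
    move=> no; left=> a Z UZ sZ aZ szZ; apply/setP => u; rewrite (in_set _ u) in_set0.
    apply: contraNF no => /andP[uX Fua].
    have szt : size (a :: Z) == k.+2 by rewrite /= szZ.
    apply/existsP; exists (Tuple szt); apply/existsP; exists u.
    by rewrite UZ sZ aZ uX.
  - case: t Ut st at_ => [[|a [|b Z]] //= szt] Ut st at_.
    have szZ : size Z = k by move/eqP: szt => -[].
    have /andP[aq allF] : (a \in q) && all (F^~ a) (b :: Z).
      have sz1 : size (b :: Z) = k.+1 by rewrite /= szZ.
      exact: head_full Ut st at_ sz1 (S0 _ _ Ut st at_ sz1).
    have /andP[Fba _] := allF.
    have rotE : rcons (b :: Z) a = rot 1 [:: a, b & Z] by rewrite rot1_cons.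
    have /andP[bq _] : (b \in q) && all (F^~ b) (rcons Z a).
      (* The last vertex has a fresh arc to [a], so the dipath closes up and can be restarted at
         [b]. This puts [b] on the ear too, and the opposite arcs between [a] and [b] contradict
         minimality. *)
      have U2 : uniq (b :: rcons Z a) by rewrite -rcons_cons rotE rot_uniq.
      have a2 : all (fun w => w \notin X) (b :: rcons Z a).
        by rewrite -rcons_cons all_rcons; case/and3P: at_ => /= -> -> ->.
      have s2 : sorted F (b :: rcons Z a).
        rewrite /= rcons_path; case/andP: st => _ -> /=.
        exact: (allP allF _ (mem_last b Z)).
      have sz2 : size (rcons Z a) = k.+1 by rewrite size_rcons szZ.
      exact: head_full U2 s2 a2 sz2 (S0 _ _ U2 s2 a2 sz2).
    have Fab : F a b by case/andP: st.
    have ab : a != b by move: Ut; rewrite inE negb_or -andbA => /and3P[].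
    by case: (min_ear_chord eq qmin aq bq ab (FD _ _ Fab) (FD _ _ Fba)); apply: FA.
  - case/and4P: Dt => UZ sZ aZ /eqP szZ.
    apply: (win x y (u :: a :: Z)) => //; rewrite ?[size _]/= ?szZ //.
      rewrite cons_uniq UZ andbT; apply/negP => /(allP aZ).
      by rewrite uX.
    by rewrite /= -/A -/F Fua.
have [Z [UZ sZ aZ szZ]] := inner_path irr dout din UP eq wX.
rewrite -/X -/A -/F in sZ aZ.
case: Z UZ sZ aZ szZ => [//|a Z] UZ sZ aZ [szZ].
pose b := last a Z; have bZ : b \in a :: Z by apply: mem_last.
have aX : a \notin X by case/andP: aZ.
have bX : b \notin X by apply: (allP aZ).
(* At most [k] in-neighbours of [a] lie on [Z], so at least two come from [X] by fresh arcs or along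
   the ear, the ear giving at most one. *)
have inS : 0 < #|[set w in X | F w a]| /\
    (#|[set w in X | F w a]| <= 1 -> a \in q).
  have := @in_count _ D X x y a q Z k.+2 irr eq aX (din a).
  rewrite -/A -/F => /(_ _)/leq_trans H.
  have {}H : k.+2 <= #|[set w in X | F w a]| + (a \in q) + k.
    apply: H; last by rewrite leq_add2l -szZ card_seq_filter.
    move=> u uX uZ; apply: contra no2 => Fua.
    apply: (innerT (u :: a :: Z)); rewrite /= ?szZ //.
    - by move: UZ; rewrite /= uZ.
    - by rewrite Fua.
    - by rewrite uX.
  move: H; rewrite -[k.+2]/(2 + k) leq_add2r.
  by case: (a \in q); case: #|_| => [|[|]].
have outS : 0 < #|[set w in X | F b w]| /\
    (#|[set w in X | F b w]| <= 1 -> b \in q).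
  have := @out_count _ D X x y b q (belast a Z) k.+2 irr eq bX (dout b).
  rewrite -/A -/F => /(_ _)/leq_trans H.
  have {}H : k.+2 <= #|[set w in X | F b w]| + (b \in q) + k.
    apply: H; last by rewrite leq_add2l -szZ -(size_belast a Z) card_seq_filter.
    move=> u uX; rewrite -mem_rcons -lastI => uZ; apply: contra no2 => Fbu.
    have szu : size (rcons (a :: Z) u) = k.+2 by rewrite size_rcons /= szZ.
    apply: innerT szu.
    - by rewrite rcons_uniq uZ.
    - by rewrite /= rcons_path Fbu andbT.
    - by rewrite all_rcons aZ andbT.
  move: H; rewrite -[k.+2]/(2 + k) leq_add2r.
  by case: (b \in q); case: #|_| => [|[|]].
have ext x' y' u v : ear D X x' q y' -> u \in X -> v \in X -> u != v ->
    sorted (fresh D X (path_arcs (x' :: rcons q y'))) (a :: Z) ->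
    fresh D X (path_arcs (x' :: rcons q y')) u a ->
    fresh D X (path_arcs (x' :: rcons q y')) b v ->
    exists P', [/\ uniq P', sorted D P', size P' = k.+3
      & #|X| < #|scc (del_arcs D (path_arcs P')) x0|].
  move=> eq' uX vX uv sZ' Fua Fbv.
  apply: (win x' y' (u :: rcons (a :: Z) v)) => //.
  - have nZ z : z \in X -> z \notin a :: Z.
      by move=> zX; apply/negP => /(allP aZ); rewrite zX.
    by rewrite cons_uniq rcons_uniq UZ (nZ v vX) mem_rcons inE negb_or uv (nZ u uX).
  - by rewrite /= size_rcons szZ.
  - by rewrite /= Fua rcons_path Fbv andbT.
case: inS => /card_gt0P[u]; rewrite (in_set _ u) => /andP[uX Fua] ina.
case: outS => /card_gt0P[v]; rewrite (in_set _ v) => /andP[vX Fbv] outb.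
have [|uv] := boolP [exists u, exists v, [&& u \in X, v \in X, u != v, F u a & F b v]].
  case/existsP=> u' /existsP[v' /and5P[u'X v'X uv' Fua' Fbv']].
  exact: ext eq u'X v'X uv' sZ Fua' Fbv'.
(* No two distinct vertices of [X] serve the two ends, so each end has exactly one fresh neighbour
   in [X], the same for both; hence both ends lie on the ear. *)
have same u' v' : u' \in X -> v' \in X -> F u' a -> F b v' -> u' = v'.
  move=> u'X v'X Fua' Fbv'; apply/eqP; apply: contraNT uv => uv'.
  by apply/existsP; exists u'; apply/existsP; exists v'; rewrite u'X v'X uv' Fua'.
have aq : a \in q.
  apply: ina; apply: card_le1 => c d; rewrite (in_set _ c) (in_set _ d).
  by case/andP=> cX Fc /andP[dX Fd]; rewrite (same c v cX vX Fc Fbv) (same d v dX vX Fd Fbv).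
have bq : b \in q.
  apply: outb; apply: card_le1 => c d; rewrite (in_set _ c) (in_set _ d).
  by case/andP=> cX Fc /andP[dX Fd]; rewrite -(same u c uX cX Fua Fc) -(same u d uX dX Fua Fd).
have {same} vu : v = u by rewrite (same u v).
rewrite {v}vu in vX Fbv *.
have ah := min_ear_head eq qmin aq uX (FD _ _ Fua).
have xaA : (x, a) \in A.
  by rewrite ah /A; case: (q) aq => // c q' _; rewrite inE /= inE eqxx.
have ux : u != x by apply: contraNneq (FA _ _ Fua) => ->.
have eq' : ear D X u q y.
  case/and5P: (eq) => Uq q0 aq' xX /andP[yX pq]; rewrite /ear Uq q0 aq' uX yX /=.
  case: (q) ah q0 pq => //= c q' <- _ /andP[_ ->]; rewrite andbT.
  exact: FD Fua.
have xX : x \in X by case/and5P: eq.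
(* Entering q from u instead of x frees the arc (x, a). *)
set A' := path_arcs (u :: rcons q y).
have AA' c d : c != u -> (c, d) \notin A -> (c, d) \notin A'.
  by move=> cu; apply: contra => /(arcs_cons cu) cd; apply: arcs_consr.
have neu c : c \notin X -> c != u by move=> cX; apply: contraNneq cX => ->.
(* The new dipath runs from [x] through [a] and [b] to [u]. Only the first arc of the ear has
   changed, so arcs starting outside [X] remain fresh. *)
apply: (ext u y x u eq' xX uX); rewrite 1?eq_sym // -/A'.
- have sub : {in [pred w | w \notin X] &, subrel F (fresh D X A')}.
    move=> c d cX dX /and3P[Dcd cdA cdX]; rewrite /fresh /= Dcd cdX andbT.
    by apply: AA' => //; apply: neu.
  exact: (sub_in_sorted sub aZ sZ).
- rewrite /fresh /= (negPf aX) andbF andbT; apply/andP; split.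
    case/and5P: eq => _ _ _ _ /andP[_]; rewrite ah.
    by case: (q) aq => //= c q' _ /andP[].
  have xu : x != u by rewrite eq_sym.
  have ay : a != y.
    by apply: contraNneq aX => ->; case/and5P: eq => _ _ _ _ /andP[].
  apply/negP => /(arcs_cons xu) /(arcs_rcons ay) /arcs_mem /andP[xq _].
  by case/and5P: eq => _ _ /allP/(_ x xq); rewrite xX.
- rewrite /fresh /= (FD _ _ Fbv) (negPf bX) andbT; apply: AA' (FA _ _ Fbv).
  exact: neu.
Qed.

(** * Iteration and the theorem *)

Lemma big_minn_le (V : finType) (d : nat) (f : V -> nat) (v : V) :
  \big[minn/d]_(w : V) f w <= f v.
Proof.
elim: (index_enum V) (mem_index_enum v) => [//|a s IH].
rewrite inE big_cons => /orP[/eqP->|/IH vs]; first exact: geq_minl.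
exact: leq_trans (geq_minr _ _) vs.
Qed.

(** Induction on the number of vertices missed by the component of [x0] plays the role of the
    extremal choice; the greedy dipath in the whole digraph starts it. *)
Lemma nonseparating_path (V : finType) (D : rel V) (x0 : V) k :
  irreflexive D -> strongly_connected D ->
  (forall v, k.+2 <= outdeg D v) -> (forall v, k.+2 <= indeg D v) ->
  exists P, [/\ uniq P, sorted D P, size P = k.+3
    & strongly_connected (del_arcs D (path_arcs P))].
Proof.
move=> irr Dst dout din.
have [P [UP sP _ szP]] : exists P : seq V,
    [/\ uniq P, sorted D P, {subset P <= [set: V]} & size P = k.+3].
  apply: long_path_out irr _ _; first by apply/set0Pn; exists x0; rewrite in_setT.
  move=> v _; apply: leq_trans (dout v) _; apply: subset_leq_card.
  by apply/subsetP => w; rewrite !(in_set _ w).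
pose X P := scc (del_arcs D (path_arcs P)) x0.
have [n] := ubnP (#|V| - #|X P|); elim: n P UP sP szP => // n IH P UP sP szP.
rewrite ltnS => leXn.
case: (boolP [forall w, w \in X P]) => [/forallP XT|].
  exists P; split=> // u v; have := XT u; have := XT v.
  rewrite !inE => /andP[xv _] /andP[_ ux].
  exact: connect_trans ux xv.
rewrite negb_forall => /existsP[w wX].
have [P' [UP' sP' szP' ltX]] := grow_scc irr Dst dout din UP wX.
apply: (IH P') => //; apply: leq_trans leXn.
by apply: ltn_sub2l => //; apply: leq_trans ltX (max_card _).
Qed.

Theorem corollary1p5 (m : nat) (hm : 2 <= m) (V : finType) (D : rel V)
  (V_nonempty : 0 < #|V|) (D_loopless : irreflexive D)
  (D_strong : strongly_connected D)
  (D_deg : maxn 2 (m - 1) <= min_semideg D) :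
  exists P : seq V,
    [/\ dipath D P, size P = m
      & strongly_connected (del_arcs D (path_arcs P))].
Proof.
have [k Dk] : exists k, maxn 2 (m - 1) = k.+2.
  by exists (maxn 2 (m - 1)).-2; case: maxn (leq_maxl 2 (m - 1)) => [|[]].
rewrite Dk leq_min in D_deg; have /andP[dout din] := D_deg.
have [x0 _] := card_gt0P V_nonempty.
have [P [UP sP szP stP]] := nonseparating_path x0 D_loopless D_strong
  (fun v => leq_trans dout (big_minn_le _ _ v))
  (fun v => leq_trans din (big_minn_le _ _ v)).
(* The dipath found has [k.+3] vertices, one more than [m] when [m] is 2, so it is cut to its first
   [m] vertices; this deletes no further arcs and keeps strong connectivity. *)
have mk : m <= k.+3 by rewrite -add1n -leq_subLR -Dk leq_maxr.
have szm : size (take m P) = m by rewrite size_take szP; case: ltngtP mk.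
exists (take m P); split=> //.
  rewrite /dipath take_uniq // take_sorted // -size_eq0 szm.
  by case: m hm {Dk D_deg mk szm}.
move=> u v; apply: connect_sub (stP u v) => a b /andP[Dab nab].
apply: connect1; apply/andP; split=> //; apply: contra nab.
case/mem_arcsP=> p1 [p2 Dt]; apply/mem_arcsP; exists p1, (p2 ++ drop m P).
by rewrite -[LHS](cat_take_drop m) Dt -catA.
Qed.
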